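(* For every set $E\in\mathcal{E}$ there are a partition $\{I_n:n\in\omega\}$ of $\omega$ into intervals and sets $J_n\subseteq 2^{I_n}$, $n\in\omega$, such that $\frac{|J_n|}{2^{|I_n|}}\le\frac12$ for each $n\in\omega$ and $$E\subseteq\{x\in 2^\omega:\ x\upharpoonright I_n\in J_n\text{ for all but finitely many }n\in\omega\}.$$
   Context: $\mathcal{E}$ denotes the $\sigma$-ideal of subsets of $2^\omega$ generated by closed null sets, i.e. $E\in\mathcal{E}$ iff $E$ is contained in a countable union of closed subsets of $2^\omega$ of measure zero for the standard product (Haar) probability measure. Intervals in the partition are finite nonempty sets of consecutive natural numbers; $2^{I_n}$ is the set of functions from $I_n$ to $\{0,1\}$. *)

(* Defs.v *)
From HB Require Import structures.
From mathcomp Require Import all_boot all_order all_algebra finmap.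
From mathcomp Require Import all_classical all_reals all_analysis.

Set Implicit Arguments.
Unset Strict Implicit.
Unset Printing Implicit Defensive.

Import Order.TTheory GRing.Theory Num.Theory.

Local Open Scope classical_set_scope.
Local Open Scope ring_scope.

(** * The product measure on the Cantor space

    It is obtained by Caratheodory extension from the algebra of the sets that
    are determined by finitely many coordinates. *)

Definition determined (n : nat) (A : set cantor_space) : Prop :=
  forall x y : cantor_space, (forall i, (i < n)%N -> x i = y i) -> A x -> A y.

Definition finitely_determined : set (set cantor_space) :=
  [set A | exists n, determined n A].

(** The infinite sequence [t] followed by zeros. *)
Definition pad n (t : n.-tuple bool) : cantor_space := fun i => nth false t i.

Lemma determined_leq m n A : (m <= n)%N -> determined m A -> determined n A.
Proof.
move=> mn dA x y xy; apply: dA => i im; apply: xy; exact: leq_trans mn.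
Qed.

Lemma determinedC n A : determined n A -> determined n (~` A).
Proof. by move=> dA x y xy nAx Ay; apply: nAx; apply: dA Ay => i /xy. Qed.

Lemma determinedU n A B :
  determined n A -> determined n B -> determined n (A `|` B).
Proof. by move=> dA dB x y xy [/(dA _ _ xy)|/(dB _ _ xy)]; [left|right]. Qed.

Lemma finitely_determined0 : finitely_determined set0.
Proof. by exists 0. Qed.

Lemma finitely_determinedU : setU_closed finitely_determined.
Proof.
move=> A B [m dA] [n dB]; exists (maxn m n); apply: determinedU.
  exact: determined_leq (leq_maxl _ _) dA.
exact: determined_leq (leq_maxr _ _) dB.
Qed.

Lemma finitely_determinedC : setC_closed finitely_determined.
Proof. by move=> A [n dA]; exists n; exact: determinedC. Qed.

Fact cantor_display : measure_display. Proof. exact. Qed.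

HB.instance Definition _ := @isAlgebraOfSets.Build cantor_display cantor_space
  finitely_determined finitely_determined0 finitely_determinedU
  finitely_determinedC.

(** The σ-algebra generated by these sets is the Borel σ-algebra, see
    [determined_open] and [closed_cantor_borel] below. *)
Definition cantor_borel : Type :=
  g_sigma_algebraType (cantor_display.-measurable : set (set cantor_space)).
HB.instance Definition _ := Measurable.on cantor_borel.

(** The basic clopen set given by the first [n] values of [x]. *)
Definition agree (n : nat) (x : cantor_space) : set cantor_space :=
  [set y | forall i, (i < n)%N -> y i = x i].

Lemma nbhs_agree (x : cantor_space) (n : nat) : nbhs x (agree n x).
Proof.
elim: n => [|n IHn]; first by apply: filterS filterT => y _ i.
have nx : nbhs x [set y : cantor_space | y n = x n].
  have /(_ x [set x n]) := @proj_continuous nat (fun=> bool) n.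
  by apply; rewrite nbhs_principalE; exact/principal_filterP.
apply: filterS (filterI IHn nx) => y [yx yn] i.
by rewrite ltnS leq_eqVlt => /orP[/eqP ->//|/yx].
Qed.

Lemma nbhs_agreeP (x : cantor_space) (U : set cantor_space) :
  nbhs x U -> exists n, agree n x `<=` U.
Proof.
pose F : set_system cantor_space :=
  filter_from [set: nat] (fun n => agree n x).
have FF : Filter F.
  apply: filter_from_filter; first by exists 0%N.
  move=> i j _ _; exists (maxn i j) => // y yx; split=> k ki; apply: yx.
    by rewrite (leq_trans ki)// leq_maxl.
  by rewrite (leq_trans ki)// leq_maxr.
have Fx : F --> x.
  apply/cvg_sup => i V [W [[B oB <-] Bx] BV]; exists i.+1 => // y yx.
  by apply: BV; rewrite /= yx.
by move=> /Fx[n _ nU]; exists n.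
Qed.

Lemma determined_open n A : determined n A -> open A.
Proof.
move=> dA; rewrite openE => x Ax; apply: filterS (nbhs_agree x n) => y yx.
by apply: dA Ax => i /yx.
Qed.

Lemma closed_cantor_borel (C : set cantor_space) :
  closed C -> measurable (C : set cantor_borel).
Proof.
move=> cC; pose Cn n : set cantor_space := [set x | C `&` agree n x !=set0].
have -> : C = \bigcap_n Cn n.
  apply/seteqP; split=> [x Cx n _|x Cx]; first by exists x.
  apply: cC => U /nbhs_agreeP[n xU]; have [y [Cy yx]] := Cx n I.
  by exists y; split=> //; exact: xU.
apply: bigcapT_measurable => n; apply: sub_sigma_algebra; exists n.
move=> x y xy [z [Cz zx]]; exists z; split=> // i im.
by rewrite zx// xy.
Qed.

Section product_measure.
Variable R : realType.
Implicit Types A B : set cantor_space.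

(** If [determined n A], then [pad t] lies in [A] iff all the extensions of [t]
    do, and this is the proportion of such words [t]. *)
Definition density n A : R :=
  #|[set t : n.-tuple bool | `[< A (pad t) >] ]%SET|%:R / 2 ^+ n.

(** Any [n] such that [determined n A] gives the same value, see
    [cantor_contentE]. *)
Definition cantor_content A : \bar R :=
  (density (xget 0%N [set n | determined n A]) A)%:E.

Lemma density_ge0 n A : 0 <= density n A.
Proof. by rewrite divr_ge0// exprn_ge0. Qed.

Lemma densityU n A B : A `&` B = set0 ->
  density n (A `|` B) = density n A + density n B.
Proof.
move=> AB; rewrite /density -mulrDl -natrD; congr (_%:R / _).
rewrite -cardsUI [X in (_ + X)%N](_ : _ = 0%N) ?addn0; last first.
  apply/eqP; rewrite cards_eq0; apply/eqP/finset.setP => t.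
  rewrite !inE; apply/negP => /andP[/asboolP At /asboolP Bt].
  by have : (A `&` B) (pad t) by []; rewrite AB.
apply: eq_card => t; rewrite !inE; apply/asboolP/orP.
  by move=> [?|?]; [left|right]; apply/asboolP.
by move=> [/asboolP|/asboolP] ?; [left|right].
Qed.

Lemma densityS n A : determined n A -> density n.+1 A = density n A.
Proof.
move=> dA; rewrite /density.
set S := finset _; set S' := finset _.
have -> : #|S| = (2 * #|S'|)%N.
  rewrite -card_bool -cardsT -cardsX.
  pose f (p : bool * n.-tuple bool) : n.+1.-tuple bool := [tuple of rcons p.2 p.1].
  have fi : injective f.
    move=> [a s] [b t] /(congr1 val) /= /rcons_inj[st ->].
    by congr pair; apply: val_inj.
  rewrite -(card_imset _ fi); apply: eq_card => t; apply/idP/imsetP.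
    rewrite inE => /asboolP At.
    case/tupleP: t At => a s; set t := cons_tuple _ _ => At.
    have st : size t = n.+1 by rewrite size_tuple.
    pose u := [tuple of belast a s].
    exists (last a s, u); last first.
      by apply: val_inj; rewrite /= -lastI.
    rewrite !inE /=; apply/asboolP/asboolP; apply: (dA _ _ _ At) => i li.
    by rewrite /pad /= lastI nth_rcons size_belast size_tuple li.
  move=> [[b s]]; rewrite !inE /= => /asboolP/asboolP As ->; apply/asboolP/asboolP.
  apply: (dA _ _ _ As) => i li.
  by rewrite /pad /= nth_rcons size_tuple li.
by rewrite natrM exprS invfM mulrACA mulfV ?mul1r// pnatr_eq0.
Qed.

Lemma density_leq m n A : (m <= n)%N -> determined m A ->
  density n A = density m A.
Proof.
move=> /subnKC <- dA; elim: (n - m)%N => [|k IH]; first by rewrite addn0.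
by rewrite addnS densityS ?IH//; apply: determined_leq dA; exact: leq_addr.
Qed.

Lemma cantor_contentE n A : determined n A ->
  cantor_content A = (density n A)%:E.
Proof.
move=> dA; rewrite /cantor_content; congr (_%:E).
have /= dx : determined (xget 0%N [set n | determined n A]) A.
  exact: (@xgetPex _ 0%N [set n | determined n A] (ex_intro _ n dA)).
set k := xget _ _ in dx *.
rewrite -(density_leq (leq_maxl k n) dx).
by rewrite -(density_leq (leq_maxr k n) dA).
Qed.

Let content_ge0 A : (0 <= cantor_content A)%E.
Proof. by rewrite lee_fin density_ge0. Qed.

Let content0 : cantor_content set0 = 0%E.
Proof.
rewrite (@cantor_contentE 0)// /density; congr (_%:E).
rewrite [X in X%:R](_ : _ = 0%N) ?mul0r//; apply/eqP; rewrite cards_eq0.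
by apply/eqP/finset.setP => t; rewrite !inE; apply/asboolP.
Qed.

Let content_additive2 : semi_additive2 cantor_content.
Proof.
move=> A B [m dA] [n dB] _ AB.
have dA' := determined_leq (leq_maxl m n) dA.
have dB' := determined_leq (leq_maxr m n) dB.
rewrite (cantor_contentE dA') (cantor_contentE dB').
by rewrite (cantor_contentE (determinedU dA' dB')) densityU.
Qed.

Let content_additive : measure_function.semi_additive cantor_content.
Proof. by apply/additive2P => //; rewrite -semi_additive2E. Qed.

HB.instance Definition _ := isContent.Build _ _ R
  cantor_content content_ge0 content_additive.

Let content_sigma_subadditive :
  measurable_subset_sigma_subadditive cantor_content.
Proof.
move=> A F mF [n dA] AF.
have cA : compact A.
  apply: (@subclosed_compact _ _ setT) => //; last exact: cantor_space_compact.
  by rewrite -openC; exact/determined_open/determinedC/dA.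
move: cA; rewrite compact_cover => /(_ nat setT F).
move=> [i _||X _ Xc]; first by have [k /determined_open] := mF i.
  by [].
have finX : finite_set [set` X] by exact: finite_fset.
apply: (le_trans (@content_sub_fsum _ _ _ cantor_content _ _ A F finX _ _ Xc)).
- by move=> k _; exact: mF.
- by exists n.
rewrite nneseries_esum// set_true.
by rewrite esum_ge//; exists [set` X].
Qed.

HB.instance Definition _ := Content_SigmaSubAdditive_isMeasure.Build _ _ _
  cantor_content content_sigma_subadditive.

Definition cantor_measure : set cantor_borel -> \bar R :=
  measure_extension cantor_content.
HB.instance Definition _ := Measure.on cantor_measure.

Lemma cantor_measureE n A : determined n A ->
  cantor_measure A = (density n A)%:E.
Proof.
move=> dA; rewrite -(cantor_contentE dA) /cantor_measure /measure_extension.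
by rewrite measurable_mu_extE//; exists n.
Qed.

Lemma cantor_measure_agree n (x : cantor_space) :
  cantor_measure (agree n x) = (2 ^- n)%:E.
Proof.
rewrite (@cantor_measureE n); last first.
  by move=> y z yz yx i im; rewrite -yz// yx.
congr (_%:E); rewrite /density [X in X%:R](_ : _ = 1%N) ?mul1r//.
apply/eqP/cards1P; exists [tuple x i | i < n]; apply/finset.setP => t.
rewrite !inE; apply/asboolP/eqP => [tx|-> i im].
  apply: eq_from_tnth => i; rewrite tnth_mktuple (tnth_nth false).
  exact: tx.
by rewrite /pad -[i]/(val (Ordinal im)) -tnth_nth tnth_mktuple.
Qed.

Let cantor_measure_setT : cantor_measure setT = 1%E.
Proof.
have := cantor_measure_agree 0 point; rewrite expr0 invr1 => <-.
by congr cantor_measure; apply/seteqP; split.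
Qed.

HB.instance Definition _ :=
  Measure_isProbability.Build _ _ _ cantor_measure cantor_measure_setT.

End product_measure.

(** The σ-ideal generated by the closed null sets. *)
Definition closed_null_ideal (R : realType) : set (set cantor_space) :=
  [set E | exists C : nat -> set cantor_space,
    (forall k, closed (C k) /\ cantor_measure R (C k) = 0%E) /\
    E `<=` \bigcup_k C k].

(** Finite nonempty sets of consecutive natural numbers. *)
Definition nat_interval (I : {fset nat}) : Prop :=
  exists m k : nat, I = [fset i in iota m k.+1]%fset.

(** The blocks need not be listed in increasing order. *)
Definition interval_partition (I : nat -> {fset nat}) : Prop :=
  (forall n, nat_interval (I n)) /\
  partition [set: nat] (fun n => [set` I n]) [set: nat].

Definition coord_restrict (I : {fset nat}) (x : cantor_space) : {ffun I -> bool} :=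
  [ffun i => x (val i)].

(* Main.v *)
Require Import Defs.
From mathcomp Require Import all_boot all_order all_algebra finmap.
From mathcomp Require Import all_classical all_reals all_analysis.

(** A closed set [C] is the intersection of the decreasing clopen sets [hull n C]
    of the points that share their first [n] values with some point of [C]. If
    [C] is null, continuity from above makes the measure of these sets tend to
    [0] ([closed_null_density]). So for each [a] there is [b > a] such that at
    most a fraction [2^-(a+1)] of the words of length [b] are prefixes of points
    of [C]. Forgetting the first [a] letters cannot increase the number of these
    words, while it divides the number of all words by [2^a] only: hence at
    most half of the words on [[a, b)] are restrictions of points of [C]
    ([half_restrictions]).

    Now let [E] be covered by closed null sets [C k]. The finite unions
    [D n = C 0 `|` ... `|` C n] are closed and null, so the ends of the intervals
    can be chosen recursively, the [n]-th interval [I n] being one on which the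
    restrictions of points of [D n] make up at most half of the words; these
    restrictions form [J n]. A point of [C k] lies in [D n] for all [n >= k], so
    its restriction to [I n] can only be outside [J n] when [n < k]. *)

Import Order.TTheory GRing.Theory Num.Theory.

Local Open Scope classical_set_scope.
Local Open Scope ring_scope.

Definition hull (n : nat) (C : set cantor_space) : set cantor_space :=
  [set x | C `&` agree n x !=set0].

Lemma hull_determined n C : determined n (hull n C).
Proof.
by move=> x y xy [z [Cz zx]]; exists z; split=> // i im; rewrite zx// xy.
Qed.

Lemma hull_decreasing C m n : (m <= n)%N -> hull n C `<=` hull m C.
Proof.
move=> mn x [z [Cz zx]]; exists z; split=> // i im.
by apply: zx; exact: leq_trans mn.
Qed.

Lemma bigcap_hull C : closed C -> \bigcap_n hull n C = C.
Proof.
move=> cC; apply/seteqP; split=> [x Cx|x Cx n _]; last by exists x.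
apply: cC => U /nbhs_agreeP[n xU]; have [y [Cy yx]] := Cx n I.
by exists y; split=> //; exact: xU.
Qed.

Lemma closed_null_density (R : realType) (C : set cantor_space) (e : R) :
  closed C -> cantor_measure R C = 0%E -> 0 < e ->
  \forall n \near \oo, density R n (hull n C) < e.
Proof.
move=> cC C0 e0.
have mH n : measurable (hull n C : set cantor_borel).
  by apply: sub_sigma_algebra; exists n; exact: hull_determined.
have : cantor_measure R (hull n C) @[n --> \oo] --> cantor_measure R C.
  rewrite -[in X in _ --> X](bigcap_hull C cC).
  apply: (@nonincreasing_cvg_mu _ _ _ (cantor_measure R)) => //.
  - by rewrite /= (cantor_measureE R (hull_determined 0 C)) ltry.
  - exact: bigcapT_measurable.
  - by move=> m n mn; apply/subsetPset; exact: hull_decreasing.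
rewrite C0.
under eq_fun do rewrite (cantor_measureE R (hull_determined _ C)).
move/fine_cvgP => [_ /cvgr_lt]; exact.
Qed.

Definition block (a b : nat) : {fset nat} := [fset i in iota a (b - a)]%fset.

Lemma in_block a b i : (a <= b)%N -> (i \in block a b) = (a <= i < b)%N.
Proof. by move=> ab; rewrite !inE mem_iota subnKC. Qed.

Lemma card_block a b : #|` block a b| = (b - a)%N.
Proof. by rewrite card_fseq undup_id ?iota_uniq// size_iota. Qed.

Definition restrictions (F : {fset nat}) (C : set cantor_space) :
    {set {ffun F -> bool}} :=
  [set f | `[< exists2 x, C x & f = coord_restrict F x >]]%SET.

(** A restriction to [block a b] of a point of [C] is the end of a word counted
    by [density b (hull b C)]. *)
Lemma card_restrictions (R : realType) a b C : (a <= b)%N ->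
  #|restrictions (block a b) C|%:R <= density R b (hull b C) * 2 ^+ b.
Proof.
move=> ab; rewrite /density divfK ?expf_neq0 ?pnatr_eq0// ler_nat.
set S := finset _.
pose g (t : b.-tuple bool) := coord_restrict (block a b) (pad t).
apply: (leq_trans _ (leq_imset_card g (mem S))); apply: subset_leq_card.
apply/fintype.subsetP => f; rewrite inE => /asboolP[x Cx ->].
have padx i : (i < b)%N -> pad [tuple x i | i < b] i = x i.
  move=> ib; rewrite /pad -[i]/(val (Ordinal ib)) -tnth_nth.
  by rewrite tnth_mktuple.
apply/imsetP; exists [tuple x i | i < b].
  rewrite inE; apply/asboolP; exists x; split=> // i ib.
  by rewrite padx.
apply/ffunP => i; rewrite !ffunE padx//.
by have := valP i; rewrite in_block// => /andP[].
Qed.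

(** A prefix of length [a] can only weaken the bound on the proportion of words
    by the factor [2 ^ a], so [b] is chosen with [2 ^- a.+1] instead of [2^-1].
    The condition [a < b] has to be imposed separately, since for an empty [C]
    the density is small even for [b = 0]. *)
Lemma half_restrictions (R : realType) (C : set cantor_space) a :
  closed C -> cantor_measure R C = 0%E ->
  exists b, (a < b)%N /\
    #|restrictions (block a b) C|%:R / 2 ^+ #|` block a b| <= 2^-1 :> R.
Proof.
move=> cC C0.
have e0 : 0 < 2 ^- a.+1 :> R by rewrite invr_gt0 exprn_gt0.
have [b [ab bC]] := @filter_ex _ _ _ _ (filterI (nbhs_infty_gt a)
  (closed_null_density R C _ cC C0 e0)).
exists b; split=> //; rewrite card_block ler_pdivrMr ?exprn_gt0//.
apply: le_trans (card_restrictions R a b C (ltnW ab)) _.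
apply: le_trans (ler_wpM2r _ (ltW bC)) _; first exact: exprn_ge0.
rewrite -[X in _ * 2 ^+ X <= _](subnKC (ltnW ab)) exprD mulrA exprS invfM.
by rewrite divfK// expf_neq0// pnatr_eq0.
Qed.

Lemma block_partition (a : nat -> nat) :
  a 0%N = 0%N -> (forall n, (a n < a n.+1)%N) ->
  interval_partition (fun n => block (a n) (a n.+1)).
Proof.
move=> a0 aS.
have a_mono : {homo a : m n / (m <= n)%N}.
  by apply: homo_leq => // [n m p|n]; [exact: leq_trans|exact: ltnW].
have memI n i : (i \in block (a n) (a n.+1)) = (a n <= i < a n.+1)%N.
  by rewrite in_block// ltnW.
split=> [n|].
  exists (a n), (a n.+1 - a n).-1.
  by rewrite prednK ?subn_gt0.
split=> [|m n _ _ [i [/= im in_]]|n _]; last first.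
- by exists (a n); rewrite /= memI leqnn aS.
- move: im in_; rewrite !memI => /andP[mi im] /andP[ni in_].
  have := leq_ltn_trans mi in_; have := leq_ltn_trans ni im.
  case: (ltngtP m n) => // mn.
    by rewrite ltnNge a_mono.
  by move=> _; rewrite ltnNge a_mono.
- apply/seteqP; split=> // i _.
  have [m ia] : exists m, (i < a m)%N.
    exists i.+1; elim: i => [|i IH]; last exact: leq_ltn_trans IH (aS _).
    by rewrite -[X in (X < _)%N]a0.
  elim: m ia => [|n IH]; first by rewrite a0.
  by case: (ltnP i (a n)) => [/IH//|ni iS]; exists n; rewrite //= memI ni.
Qed.

Theorem lemma19 (R : realType) (E : set cantor_space) :
  closed_null_ideal R E ->
  exists (I : nat -> {fset nat}) (J : forall n : nat, {set {ffun I n -> bool}}),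
    [/\ interval_partition I,
        forall n : nat, #|J n|%:R / 2 ^+ #|` I n| <= 2^-1 :> R &
        E `<=` [set x | finite_set [set n | coord_restrict (I n) x \notin J n]]].
Proof.
move=> [C [C_closed_null EC]].
pose D n := \big[setU/set0]_(k < n.+1) C k.
have D_closed n : closed (D n).
  by apply: closed_bigsetU => k _; have [] := C_closed_null k.
have D_null n : cantor_measure R (D n) = 0%E.
  rewrite /D; elim: n.+1 => [|m IH]; first by rewrite big_ord0 measure0.
  have [cC C0] := C_closed_null m.
  rewrite big_ord_recr/= measureU0//; last exact: closed_cantor_borel.
  apply: closed_cantor_borel; apply: closed_bigsetU => k _.
  by have [] := C_closed_null k.
have [next next_half] := choice (fun p : nat * nat =>
  half_restrictions R (D p.1) p.2 (D_closed _) (D_null _)).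
(* [next (n, c)] is where the [n]-th interval ends if it starts at [c]. *)
pose a := fix a n := if n is m.+1 then next (m, a m) else 0%N.
exists (fun n => block (a n) (a n.+1)).
exists (fun n => restrictions (block (a n) (a n.+1)) (D n)).
split=> [|n|x /EC[k _ Ckx]].
- by apply: block_partition => // n; have [] := next_half (n, a n).
- by have [] := next_half (n, a n).
- apply: sub_finite_set (finite_II k) => n /=; apply: contraNT.
  rewrite -leqNgt => kn; rewrite inE; apply/asboolP; exists x => //.
  by rewrite /D -bigcup_mkord; exists k.
Qed.
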